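(* Let $M_-,M_+\in\mathbb{Z}$ with $M:=M_-+M_+\geq2$, and let $K_{\rm s}\in\{1,\dots,M-1\}$. Define rational functions recursively by $$\sigma_{R_1,M_-,M_+,K_{\rm s},k_{\rm s}}(\xi)=\begin{cases}\dfrac{\alpha_{R_1,M_-,M_+,-M_-+k_{\rm s}M}(\xi)}{\alpha_{R_1,M_--k_{\rm s},M_+-1+k_{\rm s},-M_-+k_{\rm s}M}(\xi)}& K_{\rm s}=1,\\[3mm] \displaystyle\sum_{\ell_{\rm s}=\max(0,k_{\rm s}-1)}^{\min(K_{\rm s}-1,k_{\rm s})}\sigma_{R_1,M_-,M_+,K_{\rm s}-1,\ell_{\rm s}}(\xi)\;\sigma_{R_1,M_--\ell_{\rm s},M_+-(K_{\rm s}-1)+\ell_{\rm s},1,k_{\rm s}-\ell_{\rm s}}(\xi)& K_{\rm s}\geq2,\end{cases}\qquad k_{\rm s}\in\{0,\dots,K_{\rm s}\}.$$ Then the Lagrange reconstructing polynomial can be represented as $$p_{R_1,M_-,M_+}(x_i+\xi\Delta x;x_i,\Delta x;f)=\sum_{k_{\rm s}=0}^{K_{\rm s}}\sigma_{R_1,M_-,M_+,K_{\rm s},k_{\rm s}}(\xi)\;p_{R_1,M_--k_{\rm s},M_+-K_{\rm s}+k_{\rm s}}(x_i+\xi\Delta x;x_i,\Delta x;f)$$ for all $\xi\in\mathbb{R}\setminus\mathcal{S}_{R_1,M_-,M_+,K_{\rm s}}$, $x_i\in\mathbb{R}$, $\Delta x>0$ and $f:\mathbb{R}\to\mathbb{R}$,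 and the weight-functions satisfy (as an identity of rational functions of $\xi$) the consistency condition $$\sum_{k_{\rm s}=0}^{K_{\rm s}}\sigma_{R_1,M_-,M_+,K_{\rm s},k_{\rm s}}(\xi)=1 .$$ Here $\mathcal{S}_{R_1,M_-,M_+,K_{\rm s}}$ is the set of poles of the rational weight-functions $\sigma_{R_1,M_-,M_+,K_{\rm s},k_{\rm s}}$, $k_{\rm s}\in\{0,\dots,K_{\rm s}\}$, where for $K_{\rm s}=1$ one sets $$\mathcal{S}_{R_1,M_-,M_+,1}:=\{\xi\in\mathbb{R}:\alpha_{R_1,M_--1,M_+,M_+}(\xi)=0\}=\{\xi_{R_1,M_--1,M_+,M_+,n}\;;\;n\in\{-M_-+1,\dots,M_+-1\}\},$$ and for every $K_{\rm s}\in\{1,\dots,M-1\}$ it satisfies $$\mathcal{S}_{R_1,M_-,M_+,K_{\rm s}}\subseteq\bigcup_{L_{\rm s}=0}^{K_{\rm s}-1}\bigcup_{\ell_{\rm s}=0}^{L_{\rm s}}\mathcal{S}_{R_1,M_--\ell_{\rm s},M_+-L_{\rm s}+\ell_{\rm s},1}=\Bigl\{\xi\in\mathbb{R}:\prod_{L_{\rm s}=0}^{K_{\rm s}-1}\prod_{\ell_{\rm s}=0}^{L_{\rm s}}\alpha_{R_1,M_--1-\ell_{\rm s},M_+-L_{\rm s}+\ell_{\rm s},M_+-L_{\rm s}+\ell_{\rm s}}(\xi)=0\Bigr\}.$$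
   Context: For integers $N_\pm$ (of either sign) with $N:=N_-+N_+\ge0$ and $\ell\in\{-N_-,\dots,N_+\}$, put $$\alpha_{I,N_-,N_+,\ell}(\xi)=\prod_{k=-N_-,\,k\neq\ell}^{N_+}\frac{\xi-k}{\ell-k}=\sum_{m=0}^{N}a^{N_-,N_+}_{m,\ell}\,\xi^m ,$$ which defines the coefficients $a^{N_-,N_+}_{m,\ell}$. The fundamental polynomials of Lagrange reconstruction are $$\alpha_{R_1,N_-,N_+,\ell}(\xi):=\sum_{m=0}^{N}\Bigl(\sum_{k=0}^{\lfloor (N-m)/2\rfloor}\frac{\tau_{2k}\,(m+2k)!}{m!}\,a^{N_-,N_+}_{m+2k,\ell}\Bigr)\xi^m ,$$ where $\tau_0=1$ and $\tau_{2k}=-\sum_{s=0}^{k-1}\dfrac{\tau_{2s}}{2^{2k-2s}(2k-2s+1)!}$ for $k\geq1$. The polynomial $\alpha_{R_1,N_-,N_+,\ell}$ has degree $N$ and $N$ distinct real roots $\xi_{R_1,N_-,N_+,\ell,n}$, $n\in\{-N_-,\dots,N_+\}\setminus\{\ell\}$, where $\xi_{R_1,N_-,N_+,\ell,n}$ is the unique root in $(n-\frac12,n+\frac12)$. The Lagrange reconstructing polynomial of $f:\mathbb{R}\to\mathbb{R}$ on the equidistant points $x_i+\ell\Delta x$, $\ell\in\{-N_-,\dots,N_+\}$, is $$p_{R_1,N_-,N_+}(x_i+\xi\Delta x;x_i,\Delta x;f)=\sum_{\ell=-N_-}^{N_+}\alpha_{R_1,N_-,N_+,\ell}(\xi)\,f(x_i+\ell\Delta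 x);$$ it is the unique polynomial of $x=x_i+\xi\Delta x$ whose sliding averages $\frac1{\Delta x}\int_{x-\Delta x/2}^{x+\Delta x/2}p_{R_1,N_-,N_+}(\zeta)\,d\zeta$ equal, for all $x$, the Lagrange interpolating polynomial of $f$ on these points. The $K_{\rm s}$-level (Neville) substencils of $\{i-M_-,\dots,i+M_+\}$ are $\{i-M_-+k_{\rm s},\dots,i+M_+-K_{\rm s}+k_{\rm s}\}$, $k_{\rm s}\in\{0,\dots,K_{\rm s}\}$. Sums and products of the $\sigma$'s are those of rational functions, evaluated at points that are not poles. *)

(* Defs.v *)
From HB Require Import structures.
From mathcomp Require Export all_boot all_order all_algebra.
From mathcomp Require Export boolp classical_sets reals.

Set Implicit Arguments.
Unset Strict Implicit.
Unset Printing Implicit Defensive.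

Import Order.TTheory GRing.Theory Num.Theory.
Local Open Scope classical_set_scope.
Local Open Scope quotient_scope.
Local Open Scope ring_scope.

Notation "x %:F" := (@FracField.tofrac _ x) : ring_scope.

Section RationalFunctions.
Variable R : realType.
Implicit Types (p q : {poly R}) (f : {fraction {poly R}}) (x : R).

(* [repr f] need not be in lowest terms, hence the division by the gcd. *)
Definition rnum f : {poly R} :=
  let r := repr f in \n_r %/ gcdp \n_r \d_r.
Definition rden f : {poly R} :=
  let r := repr f in \d_r %/ gcdp \n_r \d_r.

Definition is_pole f x : Prop := (rden f).[x] = 0.

(* Meaningful only when [x] is not a pole of [f]. *)
Definition reval f x : R := (rnum f).[x] / (rden f).[x].

Lemma rnum_rden f : rden f != 0 /\ f = (rnum f)%:F / (rden f)%:F.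
Proof.
rewrite /rnum /rden /=.
have nD : \d_(repr f) != 0 :> {poly R} by apply: denom_ratioP.
set n := (repr f).1; set d := (repr f).2 in nD *; set g := gcdp n d.
have nG : g != 0 by rewrite gcdp_eq0 negb_and nD orbT.
have En : n %/ g * g = n by rewrite divpK // dvdp_gcdl.
have Ed : d %/ g * g = d by rewrite divpK // dvdp_gcdr.
have nd' : d %/ g != 0 by apply: contraNneq nD => E; rewrite -Ed E mul0r.
have fE : f * d%:F = n%:F.
  rewrite -[f in LHS]reprK /FracField.tofrac; unlock.
  rewrite !piE; apply/eqmodP; rewrite /= FracField.equivfE /FracField.mulf.
  by rewrite !numden_Ratio ?oner_neq0 ?mulr1 ?mulf_neq0 ?denom_ratioP // mulrC.
have inj (u : {poly R}) : u != 0 -> u%:F != 0 by rewrite tofrac_eq0.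
split=> //; apply: (mulIf (inj _ nD)); rewrite fE -{1}En -{2}Ed !tofracM.
by rewrite mulrA divfK ?inj.
Qed.

Lemma rnum_rden_coprime f : coprimep (rnum f) (rden f).
Proof.
by apply: coprimep_div_gcd; rewrite denom_ratioP orbT.
Qed.

Lemma is_poleP f x :
  ~ is_pole f x <-> exists p q, q.[x] != 0 /\ f = p%:F / q%:F.
Proof.
have [d0 fE] := rnum_rden f; split=> [/eqP nx|[p [q [qx fE']]] /eqP dx].
  by exists (rnum f), (rden f).
have q0 : q != 0 by apply: contraNneq qx => ->; rewrite horner0.
have inj (u : {poly R}) : u != 0 -> u%:F != 0 by rewrite tofrac_eq0.
have E : rnum f * q = p * rden f.
  apply/eqP; rewrite -tofrac_eq !tofracM -eqr_div ?inj //.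
  by rewrite -fE -fE'.
have /dvdpP [s qE] : rden f %| q.
  rewrite -(@Gauss_dvdpr _ _ (rnum f)) ?E ?dvdp_mulIr //.
  by rewrite coprimep_sym rnum_rden_coprime.
by rewrite qE hornerM (eqP dx) mulr0 eqxx in qx.
Qed.

Lemma reval_frac p q x : q.[x] != 0 -> reval (p%:F / q%:F) x = p.[x] / q.[x].
Proof.
move=> qx; set f := _ / _; have [d0 fE] := rnum_rden f.
have /eqP dx : ~ is_pole f x by apply/is_poleP; exists p, q.
have q0 : q != 0 by apply: contraNneq qx => ->; rewrite horner0.
have inj (u : {poly R}) : u != 0 -> u%:F != 0 by rewrite tofrac_eq0.
have E : rnum f * q = p * rden f.
  by apply/eqP; rewrite -tofrac_eq !tofracM -eqr_div ?inj // -fE.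
by apply/eqP; rewrite /reval eqr_div // -!hornerM E.
Qed.

End RationalFunctions.

Section Reconstruction.
Variable R : realType.
Implicit Types (Nm Np Mm Mp l n : int) (m k K : nat).

(* The integers -Nm, ..., Np, in increasing order, when 0 <= Nm + Np. *)
Definition stencil Nm Np : seq int :=
  [seq j%:Z - Nm | j <- iota 0 `|(Nm + Np)%R|%N.+1].

Definition alphaI Nm Np l : {poly R} :=
  \prod_(k <- stencil Nm Np | k != l)
    ((l - k)%:~R^-1 *: ('X - (k%:~R)%:P)).

(* [taus k] is the sequence of the first k values tau_0, tau_2, ... *)
Fixpoint taus k : seq R :=
  if k is k'.+1 then
    let t := taus k' in
    rcons t (if k' == 0%N then 1 else
      - \sum_(s < k') t`_s / (2 ^+ (2 * k' - 2 * s)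
                              * ((2 * k' - 2 * s).+1)`!%:R))
  else [::].

(* [tau2 k] is tau_{2k}. *)
Definition tau2 k : R := (taus k.+1)`_k.

Lemma size_taus k : size (taus k) = k.
Proof. by elim: k => //= k IH; rewrite size_rcons IH. Qed.

Lemma nth_taus k s : (s < k)%N -> (taus k)`_s = tau2 s.
Proof.
elim: k => // k IH; rewrite ltnS leq_eqVlt => /orP[/eqP->//|lt_sk].
by rewrite /= nth_rcons size_taus lt_sk IH.
Qed.

Lemma tau2_0 : tau2 0 = 1.
Proof. by []. Qed.

Lemma tau2_rec k : (0 < k)%N ->
  tau2 k = - \sum_(s < k) tau2 s / (2 ^+ (2 * k - 2 * s)
                                    * ((2 * k - 2 * s).+1)`!%:R).
Proof.
move=> k0; rewrite {1}/tau2 /= nth_rcons size_taus ltnn eqxx.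
rewrite -[k == _]negbK -lt0n k0; congr (- _).
by apply: eq_bigr => s _; rewrite nth_taus.
Qed.

Definition alphaR Nm Np l : {poly R} :=
  let N := `|(Nm + Np)%R|%N in
  \poly_(m < N.+1)
    \sum_(k < ((N - m)./2).+1)
      (tau2 k * (m + 2 * k)`!%:R / m`!%:R) * (alphaI Nm Np l)`_(m + 2 * k).

(* The root of [alphaR Nm Np l] in (n - 1/2, n + 1/2). *)
Definition xiR Nm Np l n : R :=
  xget 0 [set x : R | n%:~R - 2^-1 < x < n%:~R + 2^-1
                      /\ root (alphaR Nm Np l) x].

(* A function of the physical variable x = x_i + z * dx. *)
Definition pR Nm Np (x_i dx : R) (f : R -> R) (x : R) : R :=
  \sum_(l <- stencil Nm Np)
    (alphaR Nm Np l).[(x - x_i) / dx] * f (x_i + l%:~R * dx).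

Definition sigma1 Mm Mp k : {fraction {poly R}} :=
  (alphaR Mm Mp (- Mm + k%:Z * (Mm + Mp)))%:F
  / (alphaR (Mm - k%:Z) (Mp - 1 + k%:Z) (- Mm + k%:Z * (Mm + Mp)))%:F.

(* K = 0 is a dummy case; max(0, k - 1) is the truncated predecessor k.-1. *)
Fixpoint sigma Mm Mp K k : {fraction {poly R}} :=
  match K with
  | 0 => 0
  | 1 => sigma1 Mm Mp k
  | K'.+1 =>
      \sum_(k.-1 <= l < (minn K' k).+1)
        sigma Mm Mp K' l
        * sigma1 (Mm - l%:Z) (Mp - K'%:Z + l%:Z) (k - l)%N
  end.

Definition poles Mm Mp K : set R :=
  [set z | exists2 k, (k <= K)%N & is_pole (sigma Mm Mp K k) z].

End Reconstruction.

Arguments alphaI R Nm Np l : clear implicits.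
Arguments alphaR R Nm Np l : clear implicits.
Arguments xiR R Nm Np l n : clear implicits.
Arguments sigma1 R Mm Mp k : clear implicits.
Arguments sigma R Mm Mp K k : clear implicits.
Arguments poles R Mm Mp K : clear implicits.

(* Main.v *)
From HB Require Import structures.
Require Import Defs.
From mathcomp Require Import all_boot all_order all_algebra.
From mathcomp Require Import boolp classical_sets reals.
From mathcomp Require Import polyrcf.
From mathcomp Require Import ring lra zify.
Set Implicit Arguments.
Unset Strict Implicit.
Unset Printing Implicit Defensive.
Import Order.TTheory GRing.Theory Num.Theory.
Local Open Scope classical_set_scope.
Local Open Scope ring_scope.

(* With [T := sum_k tau_{2k} D^{2k}], the inverse of the sliding average over
   cells of width 1, [alphaR] is [T] applied to [alphaI]. With the end points
   a = -Mm and b = Mp, the inner points mid = a+1 .. b-1 and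
   W = prod_(k in mid) (X - k), the two weights of level 1 are
     - T((X - b) W) / (M T W)   and   T((X - a) W) / (M T W),
   and the representation of level 1 is, point by point, a quadratic identity
   valid for every linear operator in place of [T]; higher levels follow by
   induction.
   For the poles one needs that [T W] and [T((X - c) W)] have no common zero.
   If [p] vanishes at an integer k, then [T p] has zero mean on the cell
   (k - 1/2, k + 1/2), hence a root there; counting degrees, [T W] has exactly
   one root, a simple one, in each cell of [mid]. At a common zero z, some real
   c would give T((X - c) W) = (X - z)^2 h. As the left side has zero mean on
   every cell of [mid], h has a root in each of these, too many for its degree. *)

(** * Poles and values of rational functions under sums and products *)

Section Regular.
Variable R : realType.
Implicit Types (f g : {fraction {poly R}}) (x : R) (p q : {poly R}).

(** Cross-multiplying with a fraction whose denominator does not vanish at [z] would force [p] to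
    vanish there. *)
Lemma root_is_pole (p q : {poly R}) (z : R) :
  q != 0 -> root q z -> ~~ root p z -> is_pole (p%:F / q%:F) z.
Proof.
move=> q0 qz; apply: contraNP => /is_poleP[p' [q' [q'z /eqP]]].
have q'0 : q' != 0 by apply: contraNneq q'z => ->; rewrite horner0.
rewrite eqr_div ?tofrac_eq0 // -!tofracM tofrac_eq => /eqP E.
have := congr1 (horner^~ z) E; rewrite /root !hornerM (rootP qz) mulr0.
by move/eqP; rewrite mulf_eq0 (negPf q'z) orbF.
Qed.

Lemma nonroot_not_pole (p q : {poly R}) (z : R) :
  ~~ root q z -> ~ is_pole (p%:F / q%:F) z.
Proof. by move=> qz; apply/is_poleP; exists p, q. Qed.

Lemma regular_poly p x : ~ is_pole p%:F x /\ reval p%:F x = p.[x].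
Proof.
have h1 : (1 : {poly R}).[x] != 0 by rewrite hornerE oner_neq0.
have -> : p%:F = p%:F / (1 : {poly R})%:F by rewrite tofrac1 divr1.
split; first by apply/is_poleP; exists p, 1.
by rewrite reval_frac // hornerE divr1.
Qed.

Lemma regular_mul f g x : ~ is_pole f x -> ~ is_pole g x ->
  ~ is_pole (f * g) x /\ reval (f * g) x = reval f x * reval g x.
Proof.
move=> /is_poleP[p [q [qx ->]]] /is_poleP[r [s [sx ->]]].
have qsx : (q * s).[x] != 0 by rewrite hornerM mulf_neq0.
rewrite mulf_div -!tofracM !reval_frac // !hornerM mulf_div.
by split=> //; apply/is_poleP; exists (p * r), (q * s).
Qed.

Lemma regular_add f g x : ~ is_pole f x -> ~ is_pole g x ->
  ~ is_pole (f + g) x /\ reval (f + g) x = reval f x + reval g x.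
Proof.
move=> /is_poleP[p [q [qx ->]]] /is_poleP[r [s [sx ->]]].
have qsx : (q * s).[x] != 0 by rewrite hornerM mulf_neq0.
have neq0 (t : {poly R}) : t.[x] != 0 -> t%:F != 0.
  by rewrite tofrac_eq0; apply: contraNneq => ->; rewrite horner0.
rewrite addf_div ?neq0 // -!tofracM -tofracD !reval_frac // hornerD !hornerM.
rewrite addf_div //.
by split=> //; apply/is_poleP; exists (p * s + r * q), (q * s).
Qed.

Lemma regular_sum (I : eqType) (r : seq I) (F : I -> {fraction {poly R}}) x :
  (forall i, i \in r -> ~ is_pole (F i) x) ->
  ~ is_pole (\sum_(i <- r) F i) x /\
  reval (\sum_(i <- r) F i) x = \sum_(i <- r) reval (F i) x.
Proof.
elim: r => [|i r IH] Fr.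
  by rewrite !big_nil -tofrac0; have := regular_poly 0 x; rewrite horner0.
have [|nr er] := IH; first by move=> j jr; apply: Fr; rewrite in_cons jr orbT.
have Fi : ~ is_pole (F i) x by apply: Fr; rewrite mem_head.
by have := regular_add Fi nr; rewrite !big_cons er.
Qed.

End Regular.

(** * Inversion of the sliding average, and the roots it forces in cells *)

Section Recon.
Variable R : realType.
Implicit Types (p q F : {poly R}) (x : R).

(* The bound [n] only truncates the series: it does not matter once the size
   of [p] is at most [2 * n]. *)
Definition recon n p : {poly R} := \sum_(k < n) tau2 R k *: p^`(2 * k).

Lemma recon_is_linear n : linear (recon n).
Proof.
move=> a p q; rewrite /recon scaler_sumr -big_split /=.
by apply: eq_bigr => k _; rewrite linearP scalerDr !scalerA mulrC.
Qed.

HB.instance Definition _ n :=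
  GRing.isLinear.Build R {poly R} {poly R} *:%R (recon n) (recon_is_linear n).

Lemma size_derivn_le p n : (size p^`(n) <= size p)%N.
Proof.
apply/leq_sizeP => j pj; rewrite coef_derivn nth_default ?mul0rn //.
exact: leq_trans pj (leq_addl _ _).
Qed.

Lemma size_recon_le n p : (size (recon n p) <= size p)%N.
Proof.
apply: (leq_trans (size_sum _ _ _)); apply/bigmax_leqP => k _.
exact: leq_trans (size_scale_leq _ _) (size_derivn_le _ _).
Qed.

(** The first [n] terms of the Taylor series for the average of [p] over a cell of width 1. *)
Definition avg n p : {poly R} :=
  \sum_(j < n) (2 ^+ (2 * j) * (2 * j).+1`!%:R)^-1 *: p^`(2 * j).

(** The recursion for [tau2] read as a Cauchy product: the series of [tau2] and of [avg] are inverse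
    to each other. *)
Lemma tau2_conv k :
  \sum_(s < k.+1) tau2 R s / (2 ^+ (2 * (k - s)) * (2 * (k - s)).+1`!%:R)
  = (k == 0%N)%:R.
Proof.
rewrite big_ord_recr /= subnn muln0 expr0 (_ : 1`! = 1)%N // mulr1 divr1.
case: k => [|k]; first by rewrite big_ord0 add0r.
rewrite tau2_rec // addrC; apply/eqP; rewrite addr_eq0; apply/eqP.
congr (- _); by apply: eq_bigr => s _; rewrite mulnBr.
Qed.

Lemma avg_recon n p : (size p <= 2 * n)%N -> avg n (recon n p) = p.
Proof.
move=> sp.
pose c j : R := (2 ^+ (2 * j) * (2 * j).+1`!%:R)^-1.
(* For fixed [s], put k = s + j; the terms with k >= n vanish, since their derivatives have order at
   least [size p]. *)
have step s : (\sum_(j < n) (tau2 R s * c j) *: p^`(2 * (s + j)))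
   = \sum_(k < n | (s <= k)%N) (tau2 R s * c (k - s)%N) *: p^`(2 * k).
  have [le_ns|/ltnW le_sn] := leqP n s.
    rewrite big1 => [|j _]; last by rewrite derivn_poly0 ?scaler0 //; lia.
    rewrite big_pred0 // => k; apply/negbTE; rewrite -ltnNge; exact: leq_trans (ltn_ord k) le_ns.
  have E (F : nat -> {poly R}) :
      \sum_(k < n | (s <= k)%N) F k = \sum_(0 <= k < n - s) F (k + s)%N.
    by rewrite -(big_addn 0 n s xpredT F) add0n (@big_nat_widenl _ _ _ s 0) //= big_mkord.
  rewrite (E (fun k => (tau2 R s * c (k - s)%N) *: p^`(2 * k))).
  rewrite -(big_mkord xpredT (fun j => (tau2 R s * c j) *: p^`(2 * (s + j)))).
  rewrite (@big_cat_nat _ _ _ (n - s)) ?leq_subr //=.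
  rewrite [X in _ + X]big_nat_cond [X in _ + X]big1 ?addr0.
    by apply: eq_bigr => k _; rewrite addnK addnC.
  by move=> k; rewrite andbT => kn; rewrite derivn_poly0 ?scaler0 //; lia.
transitivity (\sum_(s < n) \sum_(j < n) (tau2 R s * c j) *: p^`(2 * (s + j))).
  rewrite exchange_big; apply: eq_bigr => j _ /=.
  rewrite /recon linear_sum scaler_sumr; apply: eq_bigr => s _.
  rewrite linearZ /= scalerA mulrC -/(c j); congr (_ *: _).
  by rewrite mulnDr /derivn -iterD addnC.
under eq_bigr do rewrite step; rewrite (exchange_big_dep xpredT) //=.
have E k : (k < n)%N -> \sum_(i < n | (i <= k)%N) (tau2 R i * c (k - i)%N) *: p^`(2 * k)
   = (k == 0%N)%:R *: p^`(2 * k).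
  move=> kn; rewrite -tau2_conv scaler_suml.
  by rewrite (@big_ord_widen_cond _ _ _ k.+1 n xpredT (fun i => (tau2 R i * c (k - i)%N) *: p^`(2 * k))).
rewrite (eq_bigr (fun k : 'I_n => ((k : nat) == 0%N)%:R *: p^`(2 * k))); last first.
  by move=> k _; rewrite E.
case: n sp {step E} => [|n] sp; first by rewrite big_ord0; symmetry; apply/eqP; rewrite -size_poly_eq0; lia.
rewrite big_ord_recl /= scale1r big1 ?addr0 // => i _.
by rewrite scale0r.
Qed.

(** Taylor expansion of both values about [x]: in the difference the even terms cancel and the odd
    ones double. *)
Lemma avg_antideriv n F x : (size F <= 2 * n)%N ->
  F.[x + 2^-1] - F.[x - 2^-1] = (avg n F^`()).[x].
Proof.
move=> sF.
rewrite !(@nderiv_taylor_wide _ (2 * n)) //; try exact: mulrC.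
rewrite -sumrB /avg horner_sum.
rewrite -(big_mkord xpredT (fun i => F^`N(i).[x] * 2^-1 ^+ i - F^`N(i).[x] * (- 2^-1) ^+ i)).
elim: n {sF} => [|n IH]; first by rewrite big_nil big_ord0.
rewrite mulnS !big_nat_recr //= IH big_ord_recr /= -addrA; congr (_ + _).
rewrite exprNn [in X in _ + X]exprNn -signr_odd mulnC -[in X in _ + X]signr_odd /= oddM andbF /=.
rewrite expr0 mul1r subrr add0r expr1 hornerZ -derivSn nderivn_def hornerMn -mulr_natr.
rewrite exprS exprVn.
have fn : (n * 2).+1`!%:R != 0 :> R by rewrite pnatr_eq0 -lt0n fact_gt0.
by field; rewrite fn mul1r expf_neq0 // pnatr_eq0.
Qed.

Lemma antideriv_exists p : exists2 F, F^`() = p & (size F <= (size p).+1)%N.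
Proof.
exists (\poly_(i < (size p).+1) (if i is j.+1 then p`_j / j.+1%:R else 0)); last exact: size_poly.
apply/polyP => i; rewrite coef_deriv coef_poly ltnS.
case: ltnP => [|le_pi]; last by rewrite mul0rn nth_default.
by move=> _; rewrite -[LHS]mulr_natr divfK // pnatr_eq0.
Qed.

Definition cell (k : int) x := k%:~R - 2^-1 < x < k%:~R + 2^-1.

Lemma cell_inj k l x : cell k x -> cell l x -> k = l.
Proof.
move=> /andP[k1 k2] /andP[l1 l2].
have h1 : k%:~R < (l + 1)%:~R :> R by rewrite intrD; lra.
have h2 : l%:~R < (k + 1)%:~R :> R by rewrite intrD; lra.
by rewrite !ltr_int in h1 h2; lia.
Qed.

(** Expresses through an antiderivative that T p has cell averages [p]. The strict bound leaves room
    for the degree gained by integration. *)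
Lemma recon_antideriv n p : (size p < 2 * n)%N ->
  exists2 F, F^`() = recon n p &
    forall x, F.[x + 2^-1] - F.[x - 2^-1] = p.[x].
Proof.
move=> sp; have [F dF sF] := antideriv_exists (recon n p); exists F => // x.
rewrite (@avg_antideriv n) ?dF ?avg_recon //; first lia.
exact: leq_trans sF (leq_ltn_trans (size_recon_le _ _) sp).
Qed.

Lemma recon_neq0 n p : (size p <= 2 * n)%N -> p != 0 -> recon n p != 0.
Proof.
move=> sp; apply: contraNneq => r0; rewrite -(avg_recon sp) r0 /avg.
by rewrite big1 // => j _; rewrite linear0 scaler0.
Qed.

Lemma recon_cell_root n p k : (size p < 2 * n)%N -> root p k%:~R ->
  exists2 x, cell k x & root (recon n p) x.
Proof.
move=> sp /rootP pk; have [F dF incF] := recon_antideriv sp.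
have [] := @poly_rolle _ (k%:~R - 2^-1) (k%:~R + 2^-1) F.
- by lra.
- by apply/esym/eqP; rewrite -subr_eq0 incF pk.
by move=> x; rewrite in_itv dF /= => kx rx; exists x => //; apply/rootP.
Qed.

(** Cells are disjoint, so the roots chosen in them are distinct. *)
Lemma cell_root_count (s : seq int) q : q != 0 -> uniq s ->
  (forall k, k \in s -> exists2 x, cell k x & root q x) ->
  (size s < size q)%N.
Proof.
move=> q0 us rs.
have /choice [r rP] : forall k, exists x, k \in s -> cell k x /\ root q x.
  move=> k; have [/rs[x kx rx]|_] := boolP (k \in s); last by exists 0.
  by exists x.
rewrite -(size_map r); apply: max_poly_roots => //.
  by apply/allP => x /mapP[k /rP[_ rk] ->].
rewrite map_inj_in_uniq // => k l ks ls rkl.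
apply: (@cell_inj _ _ (r k)); first by have [] := rP _ ks.
by rewrite rkl; have [] := rP _ ls.
Qed.

(* A quotient with a root in every cell would have too large a degree. *)
Lemma cell_root_simple (s : seq int) p q z : p != 0 -> uniq s ->
  (size p <= (size s).+1)%N ->
  (forall k, k \in s -> exists2 x, cell k x & root p x) ->
  p = q * ('X - z%:P) ->
  exists2 k, k \in s & cell k z /\ forall y, cell k y -> ~~ root q y.
Proof.
move=> p0 us sp rp pq.
have q0 : q != 0 by apply: contraNneq p0 => q0; rewrite pq q0 mul0r.
have [k [ks kz]] : exists k, k \in s /\ forall y, cell k y -> ~~ root q y.
  apply: contrapT => nk; have : (size s < size q)%N.
    apply: cell_root_count => // k ks; apply: contrapT => nq; apply: nk.
    exists k; split=> // y ky; apply/negP => ry; apply: nq; by exists y.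
  by move: sp; rewrite pq size_Mmonic ?monicXsubC // size_XsubC addn2 /= ltnS leqNgt => /negP.
exists k => //; split=> //; have [y ky] := rp k ks.
by rewrite pq rootM (negPf (kz y ky)) root_XsubC /= => /eqP <-.
Qed.

(** If [z] lies outside (a, b), Rolle's theorem suffices. Otherwise the increments of [F] over
    [a, z] and [z, b] are opposite, so the mean value theorem gives two points where the values of
    [h] have product <= 0. *)
Lemma rolle_square F h z a b : a < b -> F.[a] = F.[b] ->
  F^`() = h * ('X - z%:P) ^+ 2 -> exists2 y, a < y < b & root h y.
Proof.
move=> ab Fab dF.
have rootF y : root F^`() y -> y != z -> root h y.
  by rewrite dF rootM => /orP[//|]; rewrite /root horner_exp sqrf_eq0 !hornerE subr_eq0 => ->.
have [/andP[az zb]|nz] := boolP (a < z < b); last first.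
  have [y] := poly_rolle ab Fab; rewrite in_itv /= => aby dy; exists y => //.
  by apply: rootF; [apply/rootP|apply: contraNneq nz => <-].
have [y1] := poly_mvt F az; rewrite in_itv /= => /andP[ay1 y1z] e1.
have [y2] := poly_mvt F zb; rewrite in_itv /= => /andP[zy2 y2b] e2.
have y12 : y1 <= y2 by apply/ltW/(lt_trans y1z).
have [|x] := @polyrcf.poly_ivt _ h y1 y2 y12; last first.
  rewrite in_itv /= => /andP[y1x xy2] hx; exists x => //.
  by rewrite (lt_le_trans ay1) // (le_lt_trans xy2).
(* Multiplied by these two positive factors, h(y1) h(y2) becomes the product of the two increments
   of [F]. *)
have d1 : 0 < (y1 - z) ^+ 2 * (z - a) by rewrite mulr_gt0 ?subr_gt0 // exprn_even_gt0 //= subr_eq0 lt_eqF.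
have d2 : 0 < (y2 - z) ^+ 2 * (b - z) by rewrite mulr_gt0 ?subr_gt0 // exprn_even_gt0 //= subr_eq0 gt_eqF.
rewrite -(pmulr_lle0 _ d1) -(pmulr_lle0 _ d2).
move: e1 e2; rewrite dF !(hornerM h) !horner_exp !hornerXsubC => e1 e2.
set t := (X in X <= 0).
have -> : t = - (F.[z] - F.[a]) ^+ 2.
  rewrite expr2 {2}Fab -mulrN opprB e1 -/(F.[b] - F.[z]) e2 /t; ring.
by rewrite oppr_le0 sqr_ge0.
Qed.

Definition nodal (s : seq int) : {poly R} := \prod_(k <- s) ('X - (k%:~R)%:P).

Lemma size_nodal s : size (nodal s) = (size s).+1.
Proof. by rewrite /nodal size_prod_XsubC. Qed.

Lemma nodal_neq0 s : nodal s != 0.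
Proof. by rewrite -size_poly_eq0 size_nodal. Qed.

Lemma root_nodal s k : k \in s -> root (nodal s) k%:~R.
Proof.
move=> ks; rewrite /nodal (big_rem k) //= rootM root_XsubC eqxx //.
Qed.

(** Locates each root of T W, with W = [nodal s], as the only one in its cell; this identifies the
    poles with the points [xiR]. *)
Lemma recon_nodal_root n s z : ((size s).+1 < 2 * n)%N -> uniq s ->
  root (recon n (nodal s)) z ->
  exists2 k, k \in s & cell k z /\
    forall y, cell k y -> root (recon n (nodal s)) y -> y = z.
Proof.
move=> sn us /factor_theorem[q uq].
have [||k ks|k ks [kz nk]] := cell_root_simple _ us _ _ uq.
- by rewrite recon_neq0 ?nodal_neq0 // size_nodal ltnW.
- by rewrite (leq_trans (size_recon_le _ _)) // size_nodal.
- by apply: recon_cell_root; rewrite ?size_nodal ?root_nodal.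
exists k => //; split=> // y ky.
by rewrite uq rootM (negPf (nk y ky)) root_XsubC => /eqP.
Qed.

(** Excludes cancellation between numerator and denominator of a weight of level 1. *)
Lemma recon_nodal_coprime n s z c0 : ((size s).+2 < 2 * n)%N -> uniq s ->
  root (recon n (nodal s)) z ->
  ~~ root (recon n (('X - c0%:P) * nodal s)) z.
Proof.
move=> sn us uz; apply/negP => tz0.
set W := nodal s in uz tz0 *.
have recC c : recon n (('X - c%:P) * W) = recon n ('X * W) - c *: recon n W.
  by rewrite mulrBl mul_polyC linearB linearZ.
(* At a root of T W the value of T((X - c) W) does not depend on c, so [c0] may be replaced by 0. *)
have tz : root (recon n ('X * W)) z.
  by move: tz0 uz; rewrite recC /root !hornerE => /eqP + /eqP u0; rewrite u0 mulr0 subr0 => ->.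
have /factor_theorem[u1 uE] := uz; have /factor_theorem[t1 tE] := tz.
have sW : size W = (size s).+1 by rewrite size_nodal.
have u1z : u1.[z] != 0.
  have [||k ks|k ks [kz nk]] := cell_root_simple _ us _ _ uE.
  - by rewrite recon_neq0 ?nodal_neq0 // sW; lia.
  - by rewrite (leq_trans (size_recon_le _ _)) // sW.
  - by apply: recon_cell_root; rewrite ?sW ?root_nodal //; lia.
  exact: nk.
(* The root [z] of T W is simple, so [u1.[z]] is nonzero; this [c] lets X - z divide T((X - c) W)
   twice. *)
pose c := t1.[z] / u1.[z].
have /factor_theorem[h hE] : root (t1 - c *: u1) z.
  by rewrite /root !hornerE divfK // subrr.
have gE : recon n (('X - c%:P) * W) = h * ('X - z%:P) ^+ 2.
  by rewrite recC tE uE scalerAl -mulrBl hE -mulrA.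
have sp : size (('X - c%:P) * W) = (size s).+2.
  by rewrite size_monicM ?monicXsubC ?nodal_neq0 // size_XsubC sW.
have g0 : recon n (('X - c%:P) * W) != 0.
  by rewrite recon_neq0 -?size_poly_eq0 ?sp //; lia.
have h0 : h != 0 by apply: contraNneq g0 => h0; rewrite gE h0 mul0r.
have : (size s < size h)%N.
  apply: cell_root_count => // k ks.
  have [|F dF incF] := @recon_antideriv n (('X - c%:P) * W); first by rewrite sp.
  have [|||y ky hy] := @rolle_square F h z (k%:~R - 2^-1) (k%:~R + 2^-1); last by exists y.
  - by lra.
  - by apply/esym/eqP; rewrite -subr_eq0 incF hornerM (rootP (root_nodal ks)) mulr0.
  - by rewrite dF.
(* The square takes up two degrees, so [size h] is at most [size s]. *)
have := size_recon_le n (('X - c%:P) * W).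
rewrite sp gE size_Mmonic ?monic_exp ?monicXsubC // size_exp_XsubC addn3 /= !ltnS.
by rewrite leqNgt => /negP.
Qed.

End Recon.

(** * Stencils with an end point split off *)

Section Stencil.
Implicit Types (Nm Np l k : int).

Lemma mem_stencil Nm Np k : 0 <= Nm + Np ->
  (k \in stencil Nm Np) = (- Nm <= k <= Np).
Proof.
move=> N0; apply/mapP/idP => [[j]|/andP[k1 k2]].
  by rewrite mem_iota => /andP[_ jN] ->; lia.
by exists `|(k + Nm)%R|%N; rewrite ?mem_iota; lia.
Qed.

Lemma stencil_uniq Nm Np : uniq (stencil Nm Np).
Proof. by rewrite map_inj_uniq ?iota_uniq // => i j; lia. Qed.

Lemma size_stencil Nm Np : size (stencil Nm Np) = `|(Nm + Np)%R|%N.+1.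
Proof. by rewrite size_map size_iota. Qed.

Lemma perm_stencil_consl Nm Np : 1 <= Nm + Np ->
  perm_eq (stencil Nm Np) (- Nm :: stencil (Nm - 1) Np).
Proof.
move=> N1; apply: uniq_perm; first exact: stencil_uniq.
  by rewrite cons_uniq stencil_uniq andbT mem_stencil; lia.
by move=> k; rewrite [RHS]in_cons !mem_stencil; lia.
Qed.

Lemma perm_stencil_consr Nm Np : 1 <= Nm + Np ->
  perm_eq (stencil Nm Np) (Np :: stencil Nm (Np - 1)).
Proof.
move=> N1; apply: uniq_perm; first exact: stencil_uniq.
  by rewrite cons_uniq stencil_uniq andbT mem_stencil; lia.
by move=> k; rewrite [RHS]in_cons !mem_stencil; lia.
Qed.

End Stencil.

(** * Lagrange polynomials through [recon], and a quadratic Neville identity *)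

Section Lagrange.
Variable R : realType.
Implicit Types (Nm Np Mm Mp l k a b : int) (s : seq int).

(** The other points may come in any order, so that end points can be moved to the front of [s]. *)
Lemma alphaI_perm Nm Np l s : perm_eq (stencil Nm Np) (l :: s) ->
  alphaI R Nm Np l = (\prod_(k <- s) (l - k)%:~R^-1) *: nodal R s.
Proof.
move=> st; rewrite /alphaI (perm_big _ st) big_cons eqxx /= /nodal -scaler_prod.
have ls : l \notin s.
  by have := stencil_uniq Nm Np; rewrite (perm_uniq st) => /andP[].
rewrite big_seq_cond [RHS]big_seq; apply: eq_bigl => k.
by have [->|] := eqVneq k l; rewrite ?(negPf ls) // andbT.
Qed.

Lemma size_alphaI_le Nm Np l : l \in stencil Nm Np ->
  (size (alphaI R Nm Np l) <= `|(Nm + Np)%R|%N.+1)%N.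
Proof.
move=> /perm_to_rem st; rewrite (alphaI_perm st).
rewrite (leq_trans (size_scale_leq _ _)) // size_nodal.
by rewrite -size_stencil (perm_size st).
Qed.

(** Coefficient m of the 2k-th derivative is (m + 2k)!/m! times coefficient m + 2k; the terms of
    [recon] with m + 2k > N, absent from [alphaR], are zero. *)
Lemma alphaR_recon n Nm Np l : l \in stencil Nm Np ->
  (`|(Nm + Np)%R| < n)%N -> alphaR R Nm Np l = recon n (alphaI R Nm Np l).
Proof.
move=> ls; rewrite /alphaR; have := size_alphaI_le ls.
set N := `|(Nm + Np)%R|%N; set p := alphaI R Nm Np l => sp Nn.
apply/polyP => m; rewrite coef_poly /recon coef_sum.
have term (k : nat) : (tau2 R k *: p^`(2 * k))`_m
    = tau2 R k * (m + 2 * k)`!%:R / m`!%:R * p`_(m + 2 * k).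
  rewrite coefZ coef_derivn addnC -!mulrA; congr (_ * _).
  rewrite -(@ffact_fact (m + 2 * k)%N (2 * k)) ?leq_addl // addnK natrM.
  by rewrite mulrA mulfK ?pnatr_eq0 -?lt0n ?fact_gt0 // mulr_natl.
have zero (k : nat) : (N < m + 2 * k)%N -> (tau2 R k *: p^`(2 * k))`_m = 0.
  by move=> mk; rewrite term [p`_ _]nth_default ?mulr0 // (leq_trans sp).
case: ltnP => [mN|Nm']; last first.
  by rewrite big1 // => k _; apply: zero; lia.
rewrite -(big_mkord xpredT (fun k : nat => (tau2 R k *: p^`(2 * k))`_m)).
rewrite (@big_cat_nat _ _ _ ((N - m)./2).+1) //=; last lia.
rewrite [X in _ + X]big_nat_cond [X in _ + X]big1 ?addr0 ?big_mkord.
  by apply: eq_bigr => k _; rewrite term.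
by move=> k /andP[/andP[k1 k2] _]; apply: zero; lia.
Qed.

(** Both sides expand to the same quadratic expression in T V, T(X V) and T(X^2 V). In use, [V] is
    the nodal polynomial of the inner points other than [l]. *)
Lemma neville_linear (T : {poly R} -> {poly R}) (V : {poly R}) (a b l : R) :
  linear T ->
  (b - a) *: (T (('X - a%:P) * (('X - b%:P) * V)) * T (('X - l%:P) * V))
  = (b - l) *: (T (('X - b%:P) * (('X - l%:P) * V)) * T (('X - a%:P) * V))
  + (l - a) *: (T (('X - a%:P) * (('X - l%:P) * V)) * T (('X - b%:P) * V)).
Proof.
move=> linT.
have E1 c : T (('X - c%:P) * V) = T ('X * V) - c%:P * T V.
  have -> : ('X - c%:P) * V = (- c) *: V + 'X * V.
    by rewrite -mul_polyC polyCN; ring.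
  by rewrite linT -mul_polyC polyCN; ring.
have E2 c d : T (('X - c%:P) * (('X - d%:P) * V))
    = T ('X * ('X * V)) - (c%:P + d%:P) * T ('X * V) + c%:P * d%:P * T V.
  have -> : ('X - c%:P) * (('X - d%:P) * V)
      = (c * d) *: V + ((- (c + d)) *: ('X * V) + 'X * ('X * V)).
    by rewrite -!mul_polyC polyCN polyCD polyCM; ring.
  by rewrite !linT -!mul_polyC polyCN polyCD polyCM; ring.
by rewrite !E1 !E2 -!mul_polyC !polyCB; ring.
Qed.

Lemma alphaR_perm n Nm Np l s : (`|(Nm + Np)%R| < n)%N ->
  perm_eq (stencil Nm Np) (l :: s) ->
  alphaR R Nm Np l = (\prod_(k <- s) (l - k)%:~R^-1) *: recon n (nodal R s).
Proof.
move=> Nn st; rewrite (@alphaR_recon n) ?(alphaI_perm st) ?linearZ //.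
by rewrite (perm_mem st) mem_head.
Qed.

Lemma nodal_cons k s : nodal R (k :: s) = ('X - (k%:~R)%:P) * nodal R s.
Proof. by rewrite /nodal big_cons. Qed.

Lemma alphaR_neq0 Nm Np l : l \in stencil Nm Np -> alphaR R Nm Np l != 0.
Proof.
move=> /perm_to_rem st.
have := alphaR_perm (leqnn _) st => ->.
rewrite scaler_eq0 negb_or andbC recon_neq0 ?nodal_neq0 //=.
  rewrite prodf_seq_neq0; apply/allP => k ks /=.
  rewrite invr_eq0 intr_eq0 subr_eq0; apply: contraTneq ks => <-.
  by have := stencil_uniq Nm Np; rewrite (perm_uniq st) => /andP[].
rewrite size_nodal; have := perm_size st; rewrite size_stencil /=; lia.
Qed.

(** The reconstructing polynomial in the reduced variable xi, for node values [v]. *)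
Definition lagR Nm Np (v : int -> R) : {poly R} :=
  \sum_(l <- stencil Nm Np) v l *: alphaR R Nm Np l.

(** * The two weights of level 1 and their poles *)

Section Neville.
Variables Mm Mp : int.
Hypothesis M2 : 2 <= Mm + Mp.
Let n := `|(Mm + Mp)%R|%N.+1.
Let mid := stencil (Mm - 1) (Mp - 1).
Let a := - Mm.
Let b := Mp.

Lemma perm_stencil_lr : perm_eq (stencil Mm Mp) (a :: b :: mid).
Proof.
rewrite (permPl (perm_stencil_consl _)); last lia.
by rewrite perm_cons perm_stencil_consr; lia.
Qed.

Lemma perm_stencil_l : perm_eq (stencil Mm (Mp - 1)) (a :: mid).
Proof. by rewrite perm_stencil_consl; lia. Qed.

Lemma perm_stencil_r : perm_eq (stencil (Mm - 1) Mp) (b :: mid).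
Proof. by rewrite perm_stencil_consr; lia. Qed.


(** [Q] is T W, and the weights of level 1 will be [S0] and [S1] over [Q]. The sign in [S0] comes
    from 1/(a - b). *)
Let Q := recon n (nodal R mid).
Let S0 := - (b - a)%:~R^-1 *: recon n (nodal R (b :: mid)).
Let S1 := (b - a)%:~R^-1 *: recon n (nodal R (a :: mid)).

Let ba0 : (b - a)%:~R != 0 :> R.
Proof. by rewrite intr_eq0 /a /b; lia. Qed.

(** Without [a], the full stencil is [b :: mid] and the left substencil [mid]; the scalar factors
    differ by 1/(a - b). *)
Lemma alphaR_endpoint_l : alphaR R Mm Mp a * Q = S0 * alphaR R Mm (Mp - 1) a.
Proof.
rewrite (@alphaR_perm n _ _ _ _ _ perm_stencil_lr) //.
rewrite (@alphaR_perm n _ _ _ _ _ perm_stencil_l); last lia.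
rewrite big_cons /S0 -!scalerAl -!scalerAr !scalerA; congr (_ *: _).
by rewrite -invrN -rmorphN opprB.
Qed.

Lemma alphaR_endpoint_r : alphaR R Mm Mp b * Q = S1 * alphaR R (Mm - 1) Mp b.
Proof.
have st : perm_eq (stencil Mm Mp) (b :: a :: mid).
  by rewrite (permPl perm_stencil_lr) (perm_catCA [:: a] [:: b]).
rewrite (@alphaR_perm n _ _ _ _ _ st) //.
rewrite (@alphaR_perm n _ _ _ _ _ perm_stencil_r); last lia.
by rewrite big_cons /S1 -!scalerAl -!scalerAr !scalerA.
Qed.

Lemma alphaR_interior l : l \in mid ->
  alphaR R Mm Mp l * Q
    = S0 * alphaR R Mm (Mp - 1) l + S1 * alphaR R (Mm - 1) Mp l.
Proof.
move=> lm; have := perm_to_rem lm; set s := rem l mid => ms.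
have [al bl] : l != a /\ l != b.
  by move: lm; rewrite mem_stencil /a /b; lia.
have stA : perm_eq (stencil Mm Mp) (l :: a :: b :: s).
  rewrite (permPl perm_stencil_lr) perm_sym.
  by rewrite (perm_catCA [:: l] [:: a; b]) /= !perm_cons perm_sym.
have st0 : perm_eq (stencil Mm (Mp - 1)) (l :: a :: s).
  rewrite (permPl perm_stencil_l) perm_sym.
  by rewrite (perm_catCA [:: l] [:: a]) /= !perm_cons perm_sym.
have st1 : perm_eq (stencil (Mm - 1) Mp) (l :: b :: s).
  rewrite (permPl perm_stencil_r) perm_sym.
  by rewrite (perm_catCA [:: l] [:: b]) /= !perm_cons perm_sym.
rewrite (@alphaR_perm n _ _ _ _ _ stA) // (@alphaR_perm n _ _ _ _ _ st0); last lia.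
rewrite (@alphaR_perm n _ _ _ _ _ st1); last lia.
have midE : nodal R mid = ('X - (l%:~R)%:P) * nodal R s.
  by rewrite -nodal_cons /nodal (perm_big _ ms).
rewrite /S0 /S1 /Q !(nodal_cons a) !(nodal_cons b) midE !big_cons.
have N := neville_linear (nodal R s) a%:~R b%:~R l%:~R (@recon_is_linear R n).
set c := \prod_(k <- s) _.
have la : l%:~R - a%:~R != 0 :> R by rewrite subr_eq0 eqr_int.
have lb : l%:~R - b%:~R != 0 :> R by rewrite subr_eq0 eqr_int.
have m0 := ba0; rewrite rmorphB /= in m0; rewrite !rmorphB /=.
rewrite -!scalerAl -!scalerAr !scalerA.
set d := (l%:~R - a%:~R)^-1 * ((l%:~R - b%:~R)^-1 * c).
(* Creates the factor b - a found on the left of [neville_linear]. *)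
have dE : d = d / (b%:~R - a%:~R) * (b%:~R - a%:~R) by rewrite divfK.
rewrite [in LHS]dE -[in LHS]scalerA N scalerDr !scalerA.
by congr (_ *: _ + _ *: _); move: (a%:~R : R) (b%:~R : R) la lb m0 @d {N dE};
  move=> x y la lb m0 /=; field; rewrite ?la ?lb ?m0.
Qed.

(** Each end point lies in one substencil only, each inner point in both, so the identity splits
    point by point. *)
Lemma neville_lagR v :
  lagR Mm Mp v * Q = S0 * lagR Mm (Mp - 1) v + S1 * lagR (Mm - 1) Mp v.
Proof.
have [[el er] ei] := (alphaR_endpoint_l, alphaR_endpoint_r, alphaR_interior).
rewrite /lagR (perm_big _ perm_stencil_lr) (perm_big _ perm_stencil_l).
rewrite (perm_big _ perm_stencil_r) /=.
clearbody S0 S1 Q; clearbody mid.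
rewrite !big_cons !mulrDl !mulrDr -!scalerAl -!scalerAr el er.
rewrite [RHS]addrACA -[RHS]addrA; do 2!congr (_ + _).
rewrite mulr_suml !mulr_sumr -big_split /= big_seq [RHS]big_seq.
apply: eq_bigr => l lm; rewrite -!scalerAl -!scalerAr -scalerDr.
by rewrite ei.
Qed.

Let mid_size : ((size mid).+2 < 2 * n)%N.
Proof. by rewrite size_stencil /n; lia. Qed.

Let Q0 : Q != 0.
Proof. by rewrite recon_neq0 ?nodal_neq0 // size_nodal; lia. Qed.

Let tofrac0 (p : {poly R}) : p != 0 -> p%:F != 0.
Proof. by rewrite tofrac_eq0. Qed.

Let sigma1_0E : sigma1 R Mm Mp 0 = S0%:F / Q%:F.
Proof.
have la : - Mm + 0%:Z * (Mm + Mp) = a by rewrite /a; lia.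
have m0 : Mm - 0%:Z = Mm by lia.
have m1 : Mp - 1 + 0%:Z = Mp - 1 by lia.
rewrite /sigma1 la m0 m1; apply/eqP.
rewrite eqr_div ?tofrac0 // -?tofracM ?tofrac_eq ?alphaR_endpoint_l //.
by apply: alphaR_neq0; rewrite (perm_mem perm_stencil_l) mem_head.
Qed.

Let sigma1_1E : sigma1 R Mm Mp 1 = S1%:F / Q%:F.
Proof.
have lb : - Mm + 1%:Z * (Mm + Mp) = b by rewrite /b; lia.
have m1 : Mp - 1 + 1%:Z = Mp by lia.
rewrite /sigma1 lb m1; apply/eqP.
rewrite eqr_div ?tofrac0 // -?tofracM ?tofrac_eq ?alphaR_endpoint_r //.
by apply: alphaR_neq0; rewrite (perm_mem perm_stencil_r) mem_head.
Qed.

Lemma neville_sigma1 v : (lagR Mm Mp v)%:F =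
  sigma1 R Mm Mp 0 * (lagR Mm (Mp - 1) v)%:F
  + sigma1 R Mm Mp 1 * (lagR (Mm - 1) Mp v)%:F.
Proof.
have E (S p : {poly R}) : S%:F / Q%:F * p%:F * Q%:F = (S * p)%:F.
  by rewrite mulrAC divfK ?tofrac0 // tofracM.
apply: (mulIf (tofrac0 Q0)); rewrite sigma1_0E sigma1_1E mulrDl !E.
by rewrite -tofracM neville_lagR tofracD.
Qed.

Lemma sigma1_sum : sigma1 R Mm Mp 0 + sigma1 R Mm Mp 1 = 1.
Proof.
rewrite sigma1_0E sigma1_1E -mulrDl -tofracD.
(* By linearity of T, since (X - a) W - (X - b) W = (b - a) W. *)
suff -> : S0 + S1 = Q by rewrite divff ?tofrac0.
rewrite /S0 /S1 scaleNr addrC -scalerBr -linearB (nodal_cons a) (nodal_cons b) -mulrBl.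
rewrite opprB [X in X * _]addrC addrA subrK -polyCB mul_polyC linearZ /= scalerA.
by rewrite -rmorphB mulVf // scale1r.
Qed.

Lemma poles1_recon : poles R Mm Mp 1 = [set z | root Q z].
Proof.
apply/seteqP; split=> z /=.
  move=> [k k1 pk]; apply: contraT => qz; move: pk; rewrite /sigma /=.
  case: k k1 => [|[|//]] _.
    by rewrite sigma1_0E => /(nonroot_not_pole qz).
  by rewrite sigma1_1E => /(nonroot_not_pole qz).
(* The weight k = 0 already has the pole: its numerator, a nonzero multiple of T((X - b) W), does
   not vanish at [z]. *)
move=> qz; exists 0%N => //=; rewrite sigma1_0E; apply: root_is_pole => //.
rewrite /S0 rootZ ?oppr_eq0 ?invr_eq0 // (nodal_cons b).
by apply: recon_nodal_coprime => //; exact: stencil_uniq.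
Qed.

(** The points of this stencil other than [Mp] form [mid], so the polynomial is a nonzero multiple
    of [Q]. *)
Lemma root_alphaR_r z : root (alphaR R (Mm - 1) Mp Mp) z = root Q z.
Proof.
have := alphaR_neq0 (l := Mp) (Nm := Mm - 1) (Np := Mp).
rewrite (perm_mem perm_stencil_r) mem_head => /(_ isT).
rewrite (@alphaR_perm n _ _ _ _ _ perm_stencil_r); last lia.
by rewrite scaler_eq0 negb_or => /andP[c0 _]; rewrite rootZ.
Qed.

Lemma poles1_alphaR :
  poles R Mm Mp 1 = [set z : R | (alphaR R (Mm - 1) Mp Mp).[z] = 0].
Proof.
rewrite poles1_recon; apply/seteqP; split=> z /=; rewrite -root_alphaR_r.
  by move/rootP.
by move=> ?; apply/rootP.
Qed.

Lemma poles1_xiR :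
  poles R Mm Mp 1 = [set xiR R (Mm - 1) Mp Mp k
                     | k in [set k : int | - Mm + 1 <= k <= Mp - 1]].
Proof.
have mem_mid k : k \in mid = (- Mm + 1 <= k <= Mp - 1).
  by rewrite mem_stencil; lia.
have xiP k : k \in mid ->
    cell k (xiR R (Mm - 1) Mp Mp k) /\ root Q (xiR R (Mm - 1) Mp Mp k).
  move=> km; rewrite -root_alphaR_r /xiR; set P := [set _ | _].
  (* Once a root exists in the cell, [xget] does not return its default 0. *)
  suff [x Px] : exists x, P x by exact: (xgetPex 0 (ex_intro _ x Px)).
  have [||x kx rx] := @recon_cell_root R n (nodal R mid) k.
  - by rewrite size_nodal ltnW.
  - exact: root_nodal.
  by exists x; split=> //; rewrite root_alphaR_r.
rewrite poles1_recon; apply/seteqP; split=> z /=.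
  move=> qz; have [||k km [kz uz]] := @recon_nodal_root R n mid z _ _ qz.
  - exact: ltnW.
  - exact: stencil_uniq.
  exists k => /=; first by rewrite -mem_mid.
  by have [kx rx] := xiP _ km; apply: uz.
by move=> [k]; rewrite -mem_mid => /xiP[_ rk] <-.
Qed.

End Neville.

End Lagrange.

(** * Induction on the level of the substencils *)

Section Levels.
Variables (R : realType) (Mm Mp : int).

Lemma sigmaS K k : (0 < K)%N -> sigma R Mm Mp K.+1 k =
  \sum_(k.-1 <= l < (minn K k).+1) sigma R Mm Mp K l
    * sigma1 R (Mm - l%:Z) (Mp - K%:Z + l%:Z) (k - l)%N.
Proof. by case: K. Qed.

(** Stated for any [F] obeying the one-level relation, because it serves twice: for the
    reconstructing polynomials and for the constant 1. *)
Lemma sigma_expand (F : int -> int -> {fraction {poly R}}) K :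
  (forall Nm Np, 2 <= Nm + Np ->
     F Nm Np = sigma1 R Nm Np 0 * F Nm (Np - 1)
               + sigma1 R Nm Np 1 * F (Nm - 1) Np) ->
  (0 < K)%N -> K%:Z <= Mm + Mp - 1 ->
  F Mm Mp = \sum_(k < K.+1) sigma R Mm Mp K k
                            * F (Mm - k%:Z) (Mp - K%:Z + k%:Z).
Proof.
move=> FS; elim: K => // -[|K] IH _ KM.
  rewrite !big_ord_recr big_ord0 /= add0r FS; last lia.
  by congr (_ * F _ _ + _ * F _ _); lia.
rewrite IH //; last lia.
set s := sigma R Mm Mp K.+1.
pose t (l : nat) := sigma1 R (Mm - l%:Z) (Mp - K.+1%:Z + l%:Z).
pose G (k : nat) := F (Mm - k%:Z) (Mp - K.+2%:Z + k%:Z).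
(* A fixed range with a condition allows the two sums to be exchanged. *)
have sumE (k : 'I_K.+3) : sigma R Mm Mp K.+2 k * G k =
    \sum_(l < K.+2 | (k.-1 <= l <= k)%N) s l * t l (k - l)%N * G k.
  rewrite sigmaS // mulr_suml.
  rewrite (big_nat_widenl _ 0) // (big_nat_widen _ _ K.+2); last lia.
  rewrite big_mkord; apply: eq_bigl => l; have := ltn_ord l; lia.
rewrite (eq_bigr _ (fun k _ => sumE k)) (exchange_big_dep xpredT) //=.
apply: eq_bigr => l _; have lK := ltn_ord l.
have l0 : (l < K.+3)%N by lia.
have l1 : (l.+1 < K.+3)%N by lia.
(* For fixed [l] only k = l and k = l + 1 remain: the two substencils of the [l]-th one. *)
rewrite (bigD1 (Ordinal l0)) /=; last lia.
rewrite (bigD1 (Ordinal l1)) /=; last by rewrite -val_eqE /=; lia.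
rewrite big1 ?addr0; last by move=> k; rewrite -!val_eqE /=; lia.
rewrite FS; last lia.
rewrite mulrDr !mulrA subnn subSnn /t /G.
congr (_ * F _ _ + _ * F _ _); lia.
Qed.

Lemma poles_sub K : (0 < K)%N ->
  poles R Mm Mp K `<=`
    \bigcup_(L in [set L : nat | (L <= K - 1)%N])
      \bigcup_(l in [set l : nat | (l <= L)%N])
        poles R (Mm - l%:Z) (Mp - L%:Z + l%:Z) 1.
Proof.
elim: K => // -[|K] IH _ z.
  move=> pz; exists 0%N => //=; exists 0%N => //=.
  have m0 : Mm - 0%:Z = Mm by lia.
  by have p0 : Mp - 0%:Z + 0%:Z = Mp; [lia | rewrite m0 p0].
(* Away from all poles of level 1, every factor of every summand is regular: the first by induction,
   the new [sigma1] by the case L = K + 1. *)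
move=> [k kK]; apply: contraPP => nz; rewrite sigmaS //.
rewrite big_nat_cond -big_filter.
apply: (proj1 (regular_sum _)) => l; rewrite mem_filter andbT => /andP[kl _].
apply: (proj1 (regular_mul _ _)) => pz; apply: nz.
  have [||L LK [m mL pm]] := IH _ z; [by [] | by exists l => //; lia |].
  by exists L; [move: LK => /=; lia | exists m].
exists K.+1 => /=; first lia.
exists l => /=; first lia.
by exists (k - l)%N => //; lia.
Qed.

End Levels.

(** * Return to the physical variable, and the complete statement *)

Lemma pR_lagR (R : realType) (Nm Np : int) (x_i dx z : R) (f : R -> R) :
  dx != 0 -> pR Nm Np x_i dx f (x_i + z * dx)
             = (lagR Nm Np (fun l => f (x_i + l%:~R * dx))).[z].
Proof.
move=> dx0; rewrite /pR /lagR horner_sum addrAC subrr add0r mulfK //.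
by apply: eq_bigr => l _; rewrite hornerZ mulrC.
Qed.

Theorem proposition4p5 (R : realType) (Mm Mp : int) (hM : 2 <= Mm + Mp)
    (K : nat) (hK1 : (1 <= K)%N) (hKM : K%:Z <= Mm + Mp - 1) :
  (forall (z x_i dx : R) (f : R -> R), 0 < dx -> ~ poles R Mm Mp K z ->
     pR Mm Mp x_i dx f (x_i + z * dx) =
     \sum_(k < K.+1) reval (sigma R Mm Mp K k) z
       * pR (Mm - k%:Z) (Mp - K%:Z + k%:Z) x_i dx f (x_i + z * dx))
  /\ \sum_(k < K.+1) sigma R Mm Mp K k = 1
  /\ poles R Mm Mp 1 = [set z : R | (alphaR R (Mm - 1) Mp Mp).[z] = 0]
  /\ poles R Mm Mp 1 = [set xiR R (Mm - 1) Mp Mp n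
                         | n in [set n : int | - Mm + 1 <= n <= Mp - 1]]
  /\ poles R Mm Mp K `<=`
       \bigcup_(L in [set L : nat | (L <= K - 1)%N])
         \bigcup_(l in [set l : nat | (l <= L)%N])
           poles R (Mm - l%:Z) (Mp - L%:Z + l%:Z) 1
  /\ \bigcup_(L in [set L : nat | (L <= K - 1)%N])
       \bigcup_(l in [set l : nat | (l <= L)%N])
         poles R (Mm - l%:Z) (Mp - L%:Z + l%:Z) 1
     = [set z : R | \prod_(L < K) \prod_(l < L.+1)
          (alphaR R (Mm - 1 - l%:Z) (Mp - L%:Z + l%:Z)
                    (Mp - L%:Z + l%:Z)).[z] = 0].
Proof.
split.
  move=> z x_i dx f /lt0r_neq0 dx0 nz.
  rewrite pR_lagR //; set v := fun l => _.
  (* An identity of rational functions, to be evaluated at [z], where no weight has a pole. *)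
  have E := sigma_expand (F := fun Nm Np => (lagR Nm Np v)%:F)
    (fun Nm Np h => neville_sigma1 h v) hK1 hKM.
  have [_ <-] := regular_poly (lagR Mm Mp v) z.
  have reg (k : 'I_K.+1) : ~ is_pole (sigma R Mm Mp K k) z.
    by move=> pk; apply: nz; exists k => //; rewrite -ltnS.
  rewrite E (proj2 (regular_sum _)).
    apply: eq_bigr => k _; rewrite pR_lagR //.
    have [np re] := regular_poly (lagR (Mm - k%:Z) (Mp - K%:Z + k%:Z) v) z.
    by have [_ ->] := regular_mul (reg k) np; rewrite re.
  move=> k _; have [np _] := regular_poly (lagR (Mm - k%:Z) (Mp - K%:Z + k%:Z) v) z.
  by have [] := regular_mul (reg k) np.
split.
  have := sigma_expand (R := R) (F := fun _ _ => 1) _ hK1 hKM => /= -> //.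
    by apply: eq_bigr => k _; rewrite mulr1.
  by move=> Nm Np h; rewrite !mulr1 sigma1_sum.
split; first exact: poles1_alphaR.
split; first exact: poles1_xiR.
split; first exact: poles_sub.
(* As L <= K - 1 <= M - 2, these substencils keep at least three points, as level 1 requires. *)
have rootE (L l : nat) (z : R) : (L <= K - 1)%N ->
    poles R (Mm - l%:Z) (Mp - L%:Z + l%:Z) 1 z <->
    (alphaR R (Mm - 1 - l%:Z) (Mp - L%:Z + l%:Z) (Mp - L%:Z + l%:Z)).[z] = 0.
  by move=> LK; rewrite poles1_alphaR ?[Mm - 1 - _]addrAC //; lia.
apply/seteqP; split=> z /=.
  move=> [L /= LK [l /= lL /(rootE _ _ _ LK) pz]].
  have LK' : (L < K)%N by lia.
  rewrite (bigD1 (Ordinal LK')) //= (bigD1 (Ordinal (n := L.+1) (m := l) lL)) //=.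
  by rewrite pz !mul0r.
move=> /eqP /prodf_eq0[L _ /prodf_eq0[l _ /eqP pz]].
have LK : (L <= K - 1)%N by have := ltn_ord L; lia.
exists L => //=; exists l; first by rewrite /= -ltnS.
exact/rootE.
Qed.
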